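(* Let $\mathcal A$ be an Archimedean $f$-algebra, $\varphi\in\Phi_1(\mathcal A)$ and $a\in\mathcal A$. Then $a\varphi\in\Phi_1(\mathcal A)$. In particular, $\Phi_1(\mathcal A)$ is an $f$-subalgebra and a ring ideal of $\mathcal A$.
   Context: An $\ell$-algebra is a real vector lattice $\mathcal A$ equipped with an associative bilinear multiplication such that $a,b\ge 0$ implies $ab\ge 0$. An $f$-algebra is an $\ell$-algebra in which $a\wedge b=0$ and $c\ge 0$ imply $(ac)\wedge b=(ca)\wedge b=0$. All vector lattices are Archimedean (Archimedean $f$-algebras are commutative); no multiplicative unit is assumed. Let $V$ be an Archimedean vector lattice with positive cone $V_+$. An element $\varphi\in V$ is finite if there is $z\in V_+$ such that for every $x\in V$ there is a number $c_x>0$ with $|x|\wedge n|\varphi|\le c_x z$ for all $n\in\mathbb N$. $\Phi_1(V)$ denotes the set of all finite elements of $V$; it is an order ideal of $V$. An $f$-subalgebra is a vector sublattice closed under multiplication which is an $f$-algebra under the induced structure. *)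

(* Defs.v *)
From HB Require Import structures.
From mathcomp Require Import all_boot all_order all_algebra.
From mathcomp Require Import boolp classical_sets reals.

Set Implicit Arguments.
Unset Strict Implicit.
Unset Printing Implicit Defensive.

Import Order.TTheory GRing.Theory Num.Theory.

Local Open Scope ring_scope.

(* The lattice operations are fields of this mixin because Order.Lattice cannot
   be joined with GRing.Zmodule outside the numeric hierarchy: HB rejects a
   structure inheriting from both that is declared after Num.RealDomain. *)
HB.mixin Record Lmodule_isVectorLattice (R : realType) V
    of Num.POrderedZmodule V & GRing.Lmodule R V := {
  vmeet : V -> V -> V;
  vjoin : V -> V -> V;
  lexvI : forall x y z : V, (x <= vmeet y z) = (x <= y) && (x <= z);
  leUxv : forall x y z : V, (vjoin x y <= z) = (x <= z) && (y <= z);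
  vlat_leD2r : forall x y z : V, x <= y -> x + z <= y + z;
  vlat_leZ2l : forall (r : R) (x y : V), 0 <= r -> x <= y -> r *: x <= r *: y
}.

#[short(type="vectorLatticeType")]
HB.structure Definition VectorLattice (R : realType) :=
  { V of Num.POrderedZmodule V & GRing.Lmodule R V
         & Lmodule_isVectorLattice R V }.

Notation "x \wedge y" := (vmeet x y)
  (at level 48, left associativity) : ring_scope.
Notation "x \vee y" := (vjoin x y)
  (at level 52, left associativity) : ring_scope.

(* The multiplication is not that of a MathComp ring, which would be unital. *)
HB.mixin Record VectorLattice_isLAlgebra (R : realType) A
    of VectorLattice R A := {
  lmul : A -> A -> A;
  lmulA : associative lmul;
  lmulDl : left_distributive lmul +%R;
  lmulDr : right_distributive lmul +%R;
  lmulZl : forall (r : R) (a b : A), lmul (r *: a) b = r *: lmul a b;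
  lmulZr : forall (r : R) (a b : A), lmul a (r *: b) = r *: lmul a b;
  lmul_ge0 : forall a b : A, 0 <= a -> 0 <= b -> 0 <= lmul a b
}.

#[short(type="latticeAlgebraType")]
HB.structure Definition LatticeAlgebra (R : realType) :=
  { A of VectorLattice R A & VectorLattice_isLAlgebra R A }.

Notation "a ** b" := (lmul a b) (at level 40, left associativity) : ring_scope.

Definition vabs (R : realType) (V : vectorLatticeType R) (x : V) : V :=
  x \vee - x.

Definition archimedean (R : realType) (V : vectorLatticeType R) : Prop :=
  forall x y : V, 0 <= x -> (forall n : nat, x *+ n <= y) -> x = 0.

Definition f_algebra (R : realType) (A : latticeAlgebraType R) : Prop :=
  forall a b c : A, a \wedge b = 0 -> 0 <= c ->
    (a ** c) \wedge b = 0 /\ (c ** a) \wedge b = 0.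

Definition archimedean_f_algebra (R : realType) (A : latticeAlgebraType R)
    : Prop :=
  archimedean A /\ f_algebra A.

Definition finite_element (R : realType) (V : vectorLatticeType R) (phi : V)
    : Prop :=
  exists2 z : V, 0 <= z &
    forall x : V, exists2 c : R, 0 < c &
      forall n : nat, vabs x \wedge (vabs phi *+ n) <= c *: z.

Definition Phi1 (R : realType) (V : vectorLatticeType R) : set V :=
  [set phi | finite_element phi]%classic.
Arguments Phi1 {R} V.

Record vector_sublattice (R : realType) (V : vectorLatticeType R) (S : set V)
    : Prop := VectorSublattice {
  vsub0 : S 0;
  vsubD : forall x y : V, S x -> S y -> S (x + y);
  vsubZ : forall (r : R) (x : V), S x -> S (r *: x);
  vsubI : forall x y : V, S x -> S y -> S (x \wedge y);
  vsubU : forall x y : V, S x -> S y -> S (x \vee y)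
}.

Record l_subalgebra (R : realType) (A : latticeAlgebraType R) (S : set A)
    : Prop := LSubalgebra {
  lsub_sublattice : vector_sublattice S;
  lsubM : forall x y : A, S x -> S y -> S (x ** y)
}.

(* The subset S as a type.  The closure proof is a phantom argument that makes
   the restricted operations available as canonical structures. *)
Definition induced (R : realType) (A : latticeAlgebraType R) (S : set A)
  (hS : l_subalgebra S) : Type := {x : A | x \in S}.

Section InducedStructure.
Variables (R : realType) (A : latticeAlgebraType R) (S : set A).
Variable hS : l_subalgebra S.
Local Notation B := (induced hS).

HB.instance Definition _ := SubChoice.copy B {x : A | x \in S}.

Lemma induced_submod_closed : subsemimod_closed (fun x : A => x \in S).
Proof.
have hV := lsub_sublattice hS; split; first split.
- by rewrite -topredE /= inE; exact: vsub0.
- by move=> x y; rewrite -!topredE /= !inE; exact: vsubD.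
- by move=> r x; rewrite -!topredE /= !inE; exact: vsubZ.
Qed.

HB.instance Definition _ :=
  GRing.SubChoice_isSubLmodule.Build R A _ B induced_submod_closed.

HB.instance Definition _ :=
  Order.SubChoice_isSubPOrder.Build ring_display A _ ring_display B.

Lemma induced_meet_subproof (x y : B) : val x \wedge val y \in S.
Proof.
have := valP x; have := valP y; rewrite !inE => Sy Sx.
exact: vsubI (lsub_sublattice hS) _ _ Sx Sy.
Qed.

Lemma induced_join_subproof (x y : B) : val x \vee val y \in S.
Proof.
have := valP x; have := valP y; rewrite !inE => Sy Sx.
exact: vsubU (lsub_sublattice hS) _ _ Sx Sy.
Qed.

Definition induced_meet (x y : B) : B :=
  exist (fun z : A => z \in S) _ (induced_meet_subproof x y).
Definition induced_join (x y : B) : B :=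
  exist (fun z : A => z \in S) _ (induced_join_subproof x y).

Lemma induced_lexI (x y z : B) :
  (x <= induced_meet y z) = (x <= y) && (x <= z).
Proof. by rewrite -!Order.le_val SubK; exact: lexvI. Qed.

Lemma induced_leUx (x y z : B) :
  (induced_join x y <= z) = (x <= z) && (y <= z).
Proof. by rewrite -!Order.le_val SubK; exact: leUxv. Qed.

Lemma induced_leD2r (x y z : B) : x <= y -> x + z <= y + z.
Proof. by rewrite -!Order.le_val !raddfD; exact: vlat_leD2r. Qed.

Lemma induced_leZ2l (r : R) (x y : B) : 0 <= r -> x <= y -> r *: x <= r *: y.
Proof. by rewrite -!Order.le_val !linearZ; exact: vlat_leZ2l. Qed.

HB.instance Definition _ :=
  Lmodule_isVectorLattice.Build R B
    induced_lexI induced_leUx induced_leD2r induced_leZ2l.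

Lemma induced_mul_subproof (x y : B) : (val x ** val y) \in S.
Proof.
by have := valP x; have := valP y; rewrite !inE => Sy Sx; exact: lsubM.
Qed.

Definition induced_mul (x y : B) : B :=
  exist (fun z : A => z \in S) _ (induced_mul_subproof x y).

Lemma val_induced_mul (x y : B) : val (induced_mul x y) = val x ** val y.
Proof. by rewrite SubK. Qed.

Lemma induced_mulA : associative induced_mul.
Proof. by move=> x y z; apply: val_inj; rewrite !val_induced_mul lmulA. Qed.

Lemma induced_mulDl : left_distributive induced_mul +%R.
Proof.
move=> x y z; apply: val_inj.
by rewrite raddfD !val_induced_mul raddfD; exact: lmulDl.
Qed.

Lemma induced_mulDr : right_distributive induced_mul +%R.
Proof.
move=> x y z; apply: val_inj.
by rewrite raddfD !val_induced_mul raddfD; exact: lmulDr.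
Qed.

Lemma induced_mulZl (r : R) (x y : B) :
  induced_mul (r *: x) y = r *: induced_mul x y.
Proof.
by apply: val_inj; rewrite linearZ !val_induced_mul linearZ; exact: lmulZl.
Qed.

Lemma induced_mulZr (r : R) (x y : B) :
  induced_mul x (r *: y) = r *: induced_mul x y.
Proof.
by apply: val_inj; rewrite linearZ !val_induced_mul linearZ; exact: lmulZr.
Qed.

Lemma induced_mul_ge0 (x y : B) : 0 <= x -> 0 <= y -> 0 <= induced_mul x y.
Proof.
by rewrite -!Order.le_val val_induced_mul !raddf0; exact: lmul_ge0.
Qed.

HB.instance Definition _ := VectorLattice_isLAlgebra.Build R B
  induced_mulA induced_mulDl induced_mulDr induced_mulZl induced_mulZr
  induced_mul_ge0.

End InducedStructure.

Definition f_subalgebra (R : realType) (A : latticeAlgebraType R) (S : set A)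
    : Prop :=
  exists hS : l_subalgebra S, archimedean_f_algebra (induced hS).

Record ring_ideal (R : realType) (A : latticeAlgebraType R) (I : set A)
    : Prop := RingIdeal {
  ideal0 : I 0;
  idealB : forall x y : A, I x -> I y -> I (x - y);
  idealMl : forall a x : A, I x -> I (a ** x);
  idealMr : forall a x : A, I x -> I (x ** a)
}.

(* Main.v *)
Require Import Defs.
From mathcomp Require Import all_boot all_order all_algebra.
From mathcomp Require Import boolp classical_sets reals.

Set Implicit Arguments.
Unset Strict Implicit.
Unset Printing Implicit Defensive.

Import Order.TTheory GRing.Theory Num.Theory.

Local Open Scope ring_scope.

(** Finiteness of [phi] says that a single [z]
    dominates, up to scalars, the part of every [x] that lives on the band
    generated by [phi].  In an f-algebra whatever is disjoint from [phi] is
    disjoint from [a ** phi] as well, so [a ** phi] lies in the band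
    [phi]^dd and the very same [z], with the same constants, witnesses its
    finiteness: multiplication enters only through disjointness.

    The step that needs the Archimedean property is [le_of_meet_multiples]: a
    positive [u] in the band generated by [p] is the supremum of the elements
    [u \wedge p *+ n], so a bound on all of these bounds [u].  It is applied
    with [p = |phi|] and [u = |x| \wedge |psi| *+ n], where [psi] is a product
    with factor [phi]; this gives [finite_element_band].

    The rest of the statement is order theory.  By the Riesz inequality
    [x \wedge (y + z) <= x \wedge y + x \wedge z], the finite elements form an
    order ideal ([finite_element_dominated]); an order ideal is closed under
    the linear and lattice operations.  The Archimedean and f-algebra axioms are
    universal statements, so every subalgebra inherits them. *)

(** * Translation and scaling of the order *)

Lemma vlerD2r (R : realType) (V : vectorLatticeType R) (z x y : V) :
  (x + z <= y + z) = (x <= y).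
Proof.
apply/idP/idP; last exact: vlat_leD2r.
by move=> /(vlat_leD2r _ _ (- z)); rewrite !addrK.
Qed.

Lemma vlerD (R : realType) (V : vectorLatticeType R) (x y z t : V) :
  x <= y -> z <= t -> x + z <= y + t.
Proof.
move=> lexy lezt; apply: (@le_trans _ _ (y + z)); first by rewrite vlerD2r.
by rewrite ![y + _]addrC vlerD2r.
Qed.

Lemma vlerBlDr (R : realType) (V : vectorLatticeType R) (x y z : V) :
  (x - y <= z) = (x <= z + y).
Proof. by rewrite -[LHS](vlerD2r y) subrK. Qed.

Lemma vsubr_ge0 (R : realType) (V : vectorLatticeType R) (x y : V) :
  (0 <= y - x) = (x <= y).
Proof. by rewrite -[LHS](vlerD2r x) add0r subrK. Qed.

Lemma vlerNl (R : realType) (V : vectorLatticeType R) (x y : V) :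
  (- x <= y) = (- y <= x).
Proof. by rewrite -[- x]add0r vlerBlDr -[- y]add0r vlerBlDr addrC. Qed.

Lemma vmulrn_wge0 (R : realType) (V : vectorLatticeType R) (n : nat) (x : V) :
  0 <= x -> 0 <= x *+ n.
Proof.
move=> x0; elim: n => [|n IHn]; rewrite ?mulr0n // mulrS.
by rewrite -[0]addr0 vlerD.
Qed.

Lemma vlerMn2r (R : realType) (V : vectorLatticeType R) (n : nat) (x y : V) :
  x <= y -> x *+ n <= y *+ n.
Proof. by rewrite -vsubr_ge0 -(vsubr_ge0 (x *+ n)) -mulrnBl; exact: vmulrn_wge0. Qed.

Lemma vlerZ2r (R : realType) (V : vectorLatticeType R) (r s : R) (x : V) :
  0 <= x -> r <= s -> r *: x <= s *: x.
Proof.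
move=> x0 rs; rewrite -vsubr_ge0 -scalerBl -(scaler0 _ (s - r)).
by rewrite vlat_leZ2l ?subr_ge0.
Qed.

Lemma double_ge0 (R : realType) (V : vectorLatticeType R) (x : V) :
  0 <= x + x -> 0 <= x.
Proof.
move=> x2; have half0 : 0 <= 2%:R^-1 :> R by rewrite invr_ge0 ler0n.
have := vlat_leZ2l _ _ _ half0 x2.
by rewrite scaler0 -mulr2n -scaler_nat scalerA mulVf ?pnatr_eq0 // scale1r.
Qed.

(** * Meets, joins and absolute values *)

Lemma leIl (R : realType) (V : vectorLatticeType R) (x y : V) :
  x \wedge y <= x.
Proof. by have := lexx (x \wedge y); rewrite lexvI => /andP[]. Qed.

Lemma leIr (R : realType) (V : vectorLatticeType R) (x y : V) :
  x \wedge y <= y.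
Proof. by have := lexx (x \wedge y); rewrite lexvI => /andP[]. Qed.

Lemma leUl (R : realType) (V : vectorLatticeType R) (x y : V) :
  x <= x \vee y.
Proof. by have := lexx (x \vee y); rewrite leUxv => /andP[]. Qed.

Lemma leUr (R : realType) (V : vectorLatticeType R) (x y : V) :
  y <= x \vee y.
Proof. by have := lexx (x \vee y); rewrite leUxv => /andP[]. Qed.

Lemma vmeetC (R : realType) (V : vectorLatticeType R) (x y : V) :
  x \wedge y = y \wedge x.
Proof. by apply/le_anti; rewrite !lexvI !leIl !leIr. Qed.

Lemma vmeet_le2 (R : realType) (V : vectorLatticeType R) (x y z t : V) :
  x <= y -> z <= t -> x \wedge z <= y \wedge t.
Proof.
move=> xy zt.
by rewrite lexvI (le_trans (leIl _ _) xy) (le_trans (leIr _ _) zt).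
Qed.

Lemma ler_vabs (R : realType) (V : vectorLatticeType R) (x : V) : x <= vabs x.
Proof. exact: leUl. Qed.

Lemma lerN_vabs (R : realType) (V : vectorLatticeType R) (x : V) :
  - x <= vabs x.
Proof. exact: leUr. Qed.

Lemma vabs_ge0 (R : realType) (V : vectorLatticeType R) (x : V) : 0 <= vabs x.
Proof.
by apply: double_ge0; rewrite -(subrr x) vlerD ?ler_vabs ?lerN_vabs.
Qed.

Lemma vabs_le (R : realType) (V : vectorLatticeType R) (x y : V) :
  (vabs x <= y) = (x <= y) && (- x <= y).
Proof. exact: leUxv. Qed.

Lemma vabsN (R : realType) (V : vectorLatticeType R) (x : V) :
  vabs (- x) = vabs x.
Proof.
have leN (y : V) : vabs (- y) <= vabs y.
  by rewrite vabs_le opprK lerN_vabs ler_vabs.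
by apply: le_anti; rewrite leN -[in vabs x](opprK x) leN.
Qed.

Lemma vabsD (R : realType) (V : vectorLatticeType R) (x y : V) :
  vabs (x + y) <= vabs x + vabs y.
Proof. by rewrite vabs_le opprD !vlerD ?ler_vabs ?lerN_vabs. Qed.

Lemma vabsZ_le (R : realType) (V : vectorLatticeType R) (r : R) (x : V) :
  vabs (r *: x) <= `|r| *: vabs x.
Proof.
rewrite vabs_le; case: (ger0P r) => [r0|/ltW r0].
  by rewrite -scalerN !vlat_leZ2l ?ler_vabs ?lerN_vabs.
have -> : r *: x = (- r) *: (- x) by rewrite scaleNr scalerN opprK.
by rewrite -scalerN opprK !vlat_leZ2l ?oppr_ge0 ?ler_vabs ?lerN_vabs.
Qed.

Lemma vabs0 (R : realType) (V : vectorLatticeType R) : vabs (0 : V) = 0.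
Proof.
by apply: le_anti; rewrite vabs_ge0 andbT vabs_le oppr0 lexx.
Qed.

Lemma vabs_leDl (R : realType) (V : vectorLatticeType R) (x y : V) :
  vabs x <= vabs x + vabs y.
Proof. by rewrite -[leLHS]addr0 vlerD ?vabs_ge0. Qed.

Lemma vabs_leDr (R : realType) (V : vectorLatticeType R) (x y : V) :
  vabs y <= vabs x + vabs y.
Proof. by rewrite addrC vabs_leDl. Qed.

Lemma vabsU_le (R : realType) (V : vectorLatticeType R) (x y : V) :
  vabs (x \vee y) <= vabs x + vabs y.
Proof.
rewrite vabs_le leUxv; apply/andP; split; first (apply/andP; split).
- exact: le_trans (ler_vabs x) (vabs_leDl x y).
- exact: le_trans (ler_vabs y) (vabs_leDr x y).
rewrite vlerNl; apply: le_trans (leUl x y); rewrite vlerNl.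
exact: le_trans (lerN_vabs x) (vabs_leDl x y).
Qed.

Lemma vabsI_le (R : realType) (V : vectorLatticeType R) (x y : V) :
  vabs (x \wedge y) <= vabs x + vabs y.
Proof.
rewrite vabs_le vlerNl lexvI; apply/and3P; split.
- exact: le_trans (leIl x y) (le_trans (ler_vabs x) (vabs_leDl x y)).
- by rewrite vlerNl; exact: le_trans (lerN_vabs x) (vabs_leDl x y).
- by rewrite vlerNl; exact: le_trans (lerN_vabs y) (vabs_leDr x y).
Qed.

(** The difference [x \wedge (y + z) - x \wedge z] is at most [x], because
    [x \wedge z] is positive, and at most [y], because subtracting [y] from
    [x \wedge (y + z)] gives a lower bound of both [x] and [z]. *)
Lemma riesz_meetD (R : realType) (V : vectorLatticeType R) (x y z : V) :
  0 <= x -> 0 <= y -> 0 <= z -> x \wedge (y + z) <= x \wedge y + x \wedge z.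
Proof.
move=> x0 y0 z0; rewrite -vlerBlDr lexvI; apply/andP; split.
  by rewrite vlerBlDr -[leLHS]addr0 vlerD ?leIl // lexvI x0.
rewrite vlerBlDr [leRHS]addrC -vlerBlDr lexvI !vlerBlDr.
by rewrite -{1}[x \wedge _]addr0 vlerD ?leIl //= addrC leIr.
Qed.

Lemma disjointMn (R : realType) (V : vectorLatticeType R) (n : nat) (d p : V) :
  0 <= d -> 0 <= p -> d \wedge p = 0 -> d \wedge (p *+ n) = 0.
Proof.
move=> d0 p0 dp; apply/le_anti; rewrite [X in _ && X]lexvI d0 vmulrn_wge0 // !andbT.
elim: n => [|n IHn]; first by rewrite mulr0n leIr.
rewrite mulrS; apply: le_trans (riesz_meetD d0 p0 (vmulrn_wge0 n p0)) _.
by rewrite dp add0r.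
Qed.

(** * Domination on bands *)

(** With [d = u - u \wedge v] and [e = d \wedge p], the bound on
    [u \wedge p *+ n] lets one more copy of [e] fit under [u] at each step, so
    all multiples of [e] lie below [u] and [e = 0].  Thus [d] is disjoint from
    [p], hence from [u]; as [d <= u], [d] vanishes. *)
Lemma le_of_meet_multiples (R : realType) (V : vectorLatticeType R)
    (hV : archimedean V) (p u v : V) :
  0 <= p -> 0 <= u -> 0 <= v ->
  (forall d : V, 0 <= d -> d \wedge p = 0 -> d \wedge u = 0) ->
  (forall n : nat, u \wedge (p *+ n) <= v) -> u <= v.
Proof.
move=> p0 u0 v0 band_u bound.
set d := u - u \wedge v.
have d0 : 0 <= d by rewrite vsubr_ge0 leIl.
have dp0 : d \wedge p = 0.
  have le_mult n : (d \wedge p) *+ n <= u \wedge (p *+ n).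
    elim: n => [|n IHn]; first by rewrite !mulr0n lexvI u0 lexx.
    rewrite !mulrS lexvI; apply/andP; split; last first.
      by rewrite vlerD ?leIr // (le_trans IHn) ?leIr.
    rewrite -[leRHS](subrK (u \wedge v)) vlerD ?leIl //.
    by rewrite (le_trans IHn) // lexvI leIl bound.
  apply: (hV _ u) => [|n]; first by rewrite lexvI d0 p0.
  exact: le_trans (le_mult n) (leIl _ _).
have led : d <= 0.
  rewrite -(band_u d d0 dp0) lexvI lexx /= vlerBlDr.
  by rewrite -[leLHS]addr0 vlerD // lexvI u0.
by move: led; rewrite vlerBlDr add0r => /le_trans; apply; exact: leIr.
Qed.

(** * Finite elements *)

(** The hypothesis on disjoint elements says that [psi] lies in the band
    generated by [phi]; the witness [z] for [phi] also serves [psi]. *)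
Lemma finite_element_band (R : realType) (V : vectorLatticeType R)
    (hV : archimedean V) (phi psi : V) :
  (forall d : V, 0 <= d -> d \wedge vabs phi = 0 -> d \wedge vabs psi = 0) ->
  finite_element phi -> finite_element psi.
Proof.
move=> band [z z0 zP]; exists z => // x; have [c c0 cP] := zP x.
exists c => // n; apply: (le_of_meet_multiples hV (p := vabs phi)).
- exact: vabs_ge0.
- by rewrite lexvI vabs_ge0 vmulrn_wge0 ?vabs_ge0.
- by rewrite -(scaler0 _ c) vlat_leZ2l // ltW.
- move=> d d0 /band -/(_ d0) dpsi; apply/le_anti.
  rewrite !lexvI d0 vabs_ge0 vmulrn_wge0 ?vabs_ge0 //= andbT.
  rewrite -(disjointMn n d0 (vabs_ge0 psi) dpsi).
  by rewrite vmeet_le2 ?leIr.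
- by move=> m; rewrite (le_trans _ (cP m)) // vmeet_le2 ?leIl.
Qed.

(** The Riesz inequality splits [|x| \wedge (|phi| + |chi|) *+ m] into two
    parts, bounded by the two witnesses, whose sum is then a witness for [psi].
    The bound has both a sum and a multiple so that sums, meets, joins and
    scalar multiples all fall under it. *)
Lemma finite_element_dominated (R : realType) (V : vectorLatticeType R)
    (k : nat) (phi chi psi : V) :
  finite_element phi -> finite_element chi ->
  vabs psi <= (vabs phi + vabs chi) *+ k -> finite_element psi.
Proof.
move=> [z z0 zP] [w w0 wP] dom; exists (z + w) => [|x].
  by rewrite -[0]addr0 vlerD.
have [c c0 cP] := zP x; have [e e0 eP] := wP x.
exists (c + e) => [|n]; first exact: addr_gt0.
apply: (@le_trans _ _ (vabs x \wedge (vabs phi *+ (k * n) + vabs chi *+ (k * n)))).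
  by rewrite vmeet_le2 // -mulrnDl mulrnA vlerMn2r.
rewrite (le_trans (riesz_meetD _ _ _)) ?vmulrn_wge0 ?vabs_ge0 //.
rewrite scalerDr vlerD //.
  by rewrite (le_trans (cP _)) // vlerZ2r // lerDl ltW.
by rewrite (le_trans (eP _)) // vlerZ2r // lerDr ltW.
Qed.

Lemma Phi1_vector_sublattice (R : realType) (V : vectorLatticeType R) :
  vector_sublattice (Phi1 V).
Proof.
split.
- exists 0 => // x; exists 1 => // n.
  by rewrite vabs0 mul0rn scaler0 leIr.
- move=> x y fx fy; apply: (@finite_element_dominated _ _ 1 x y) => //.
  exact: vabsD.
- move=> r x fx.
  apply: (@finite_element_dominated _ _ (Num.bound `|r|) x x) => //.
  apply: le_trans (vabsZ_le r x) _.
  apply: (@le_trans _ _ (vabs x *+ Num.bound `|r|)).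
    by rewrite -scaler_nat vlerZ2r ?vabs_ge0 // ltW // archi_boundP.
  by rewrite vlerMn2r ?vabs_leDl.
- move=> x y fx fy; apply: (@finite_element_dominated _ _ 1 x y) => //.
  exact: vabsI_le.
- move=> x y fx fy; apply: (@finite_element_dominated _ _ 1 x y) => //.
  exact: vabsU_le.
Qed.

(** * Products in an f-algebra *)

Lemma lmulNr (R : realType) (A : latticeAlgebraType R) (a b : A) :
  a ** (- b) = - (a ** b).
Proof. by rewrite -scaleN1r lmulZr scaleN1r. Qed.

Lemma lmulNl (R : realType) (A : latticeAlgebraType R) (a b : A) :
  (- a) ** b = - (a ** b).
Proof. by rewrite -scaleN1r lmulZl scaleN1r. Qed.

(** Both products of a factor [|.| - .] with a factor [|.| + .], which are
    positive, are added: the mixed terms cancel and twice the difference of the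
    two sides remains. *)
Lemma lmul_le_vabs (R : realType) (A : latticeAlgebraType R) (a b : A) :
  a ** b <= vabs a ** vabs b.
Proof.
rewrite -vsubr_ge0; apply: double_ge0.
have pos (x : A) : 0 <= vabs x - x by rewrite vsubr_ge0 ler_vabs.
have posN (x : A) : 0 <= vabs x + x.
  by rewrite -[x in _ + x]opprK vsubr_ge0 lerN_vabs.
have := vlerD (lmul_ge0 _ _ (pos a) (posN b))
  (lmul_ge0 _ _ (posN a) (pos b)).
rewrite addr0 !lmulDl !lmulDr !lmulNr !lmulNl.
set p := vabs a ** vabs b; set q := vabs a ** b; set r := a ** vabs b.
set s := a ** b.
suff -> : p + q + (- r - s) + (p - q + (r - s)) = p - s + (p - s) by [].
rewrite addrACA [p + q + _]addrACA subrr addr0.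
by rewrite [- r - s + _]addrACA addNr add0r addrACA.
Qed.

Lemma vabsM_le (R : realType) (A : latticeAlgebraType R) (a b : A) :
  vabs (a ** b) <= vabs a ** vabs b.
Proof.
by rewrite vabs_le lmul_le_vabs -lmulNl -(vabsN a) lmul_le_vabs.
Qed.

(** Disjointness from [phi] passes to both products with [phi], so these lie
    in the band generated by [phi]. *)
Lemma Phi1M (R : realType) (A : latticeAlgebraType R)
    (hA : archimedean_f_algebra A) (a phi : A) :
  Phi1 A phi -> Phi1 A (a ** phi) /\ Phi1 A (phi ** a).
Proof.
case: hA => arch falg fphi.
have disj (d p q : A) : 0 <= d -> vabs p <= q -> q \wedge d = 0 ->
    d \wedge vabs p = 0.
  move=> d0 pq qd; apply/le_anti; rewrite lexvI d0 vabs_ge0 andbT.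
  by rewrite -qd vmeetC vmeet_le2.
split; apply: finite_element_band fphi => // d d0;
  rewrite vmeetC => /falg /(_ (vabs_ge0 a)) [phia aphi].
- exact: disj (vabsM_le _ _) aphi.
- exact: disj (vabsM_le _ _) phia.
Qed.

(** The Archimedean and f-algebra axioms only involve operations that the
    inclusion of the subalgebra preserves and reflects. *)
Lemma induced_archimedean_f_algebra (R : realType) (A : latticeAlgebraType R)
    (S : set A) (hS : l_subalgebra S) :
  archimedean_f_algebra A -> archimedean_f_algebra (induced hS).
Proof.
move=> [arch falg]; split=> [x y x0 xny|a b c ab0 c0].
  apply: val_inj; rewrite raddf0; apply: (arch _ (val y)).
    by move: x0; rewrite -Order.le_val raddf0.
  by move=> n; have := xny n; rewrite -Order.le_val raddfMn.
have vab0 : val a \wedge val b = 0.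
  by have := congr1 val ab0; rewrite raddf0.
have vc0 : 0 <= val c by move: c0; rewrite -Order.le_val raddf0.
by have [? ?] := falg _ _ _ vab0 vc0; split; apply: val_inj; rewrite raddf0.
Qed.

Theorem theorem9 (R : realType) (A : latticeAlgebraType R)
    (hA : archimedean_f_algebra A) :
  (forall phi a : A, Phi1 A phi -> Phi1 A (a ** phi)) /\
  f_subalgebra (Phi1 A) /\ ring_ideal (Phi1 A).
Proof.
have PhiV := Phi1_vector_sublattice A.
have PhiMl a phi : Phi1 A phi -> Phi1 A (a ** phi) by case/(Phi1M hA a).
have PhiMr a phi : Phi1 A phi -> Phi1 A (phi ** a) by case/(Phi1M hA a).
split; first by move=> phi a; exact: PhiMl.
split.
  have hS : l_subalgebra (Phi1 A) by split=> // x y _; exact: PhiMl.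
  by exists hS; exact: induced_archimedean_f_algebra.
split=> //; first exact: vsub0 PhiV.
move=> x y fx fy; rewrite -scaleN1r.
exact: (vsubD PhiV fx (vsubZ PhiV _ fy)).
Qed.
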